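(* Let $\Pi$ be a partition of $[n]$. (i) $\Pi'$ is a partition of $[n+1]$ into intervals with no two consecutive nontrivial blocks. (ii) If $\Pi$ is a partition of $[n]$ into intervals with no two consecutive nontrivial blocks and $\Pi=\delta_n(\Pi)$, then $\mathrm{Comp}_{n+1}(\langle S_\Pi,\delta_n\rangle) = \langle S_{\Pi'},\delta_{n+1}\rangle$; moreover $\Pi' = \delta_{n+1}(\Pi')$.
   Context: $S_n$ is the symmetric group on $[n]=\{1,\dots,n\}$ (composition right to left); $\delta_n$ is $i\mapsto n+1-i$. For a partition $\Pi$ of $[n]$, $S_\Pi=\{\pi\in S_n: \pi(B)=B \text{ for all } B\in\Pi\}$ and $\delta_n(\Pi)=\{\delta_n(B):B\in\Pi\}$. A block is trivial if it has one element. Two blocks $B,B'$ are consecutive if $t-1\in B$ and $t\in B'$ for some $t$. Let $\widehat{\Pi}$ be the coarsest partition of $[n]$ into intervals refining $\Pi$, with blocks $[1]_{\widehat\Pi}\ni 1$ and $[n]_{\widehat\Pi}\ni n$. Define partitions of $[n+1]$: $\widehat\Pi^{1}=\{B+1 : B\in\widehat\Pi,\,1\notin B\}\cup\{([1]_{\widehat\Pi}+1)\cup\{1\}\}$ and $\widehat\Pi^{n+1}=\{B: B\in\widehat\Pi,\, n\notin B\}\cup\{[n]_{\widehat\Pi}\cup\{n+1\}\}$; $\Pi'$ is the coarsest common refinement of $\widehat\Pi^1$ and $\widehat\Pi^{n+1}$. A permutation $\pi\in S_m$ involves $\tau\in S_n$ ($n\le m$) if there are indices $i_1<\dots<i_n$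 with $\pi(i_j)<\pi(i_k)$ iff $\tau(j)<\tau(k)$ for all $j,k$; such $\tau$ is an $n$-pattern of $\pi$. For $S\subseteq S_n$, $\mathrm{Comp}_m(S)$ is the set of $\tau\in S_m$ all of whose $n$-patterns belong to $S$.
   Formalization: The equality of groups in (ii) is stated except for n = 2, Π = {{1},{2}}, where it is false: Comp_3(⟨S_Π, δ_2⟩) = S_3, but ⟨S_Π', δ_3⟩ = {id, 321}; n ≥ 1 throughout. *)

(* Defs.v *)
From mathcomp Require Import all_boot all_fingroup.

Set Implicit Arguments.
Unset Strict Implicit.
Unset Printing Implicit Defensive.

(* The element i of [n] = {1, ..., n} is represented by the ordinal i - 1 of
   'I_n.  Set partitions of [n] are partitions of [set: 'I_n] in the sense of
   finset. *)

(* Products in 'S_n compose left to right. The convention does not affect the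
   subgroups << _ >> they generate. *)

Definition delta (n : nat) : 'S_n := perm (@rev_ord_inj n).

Definition delta_part (n : nat) (P : {set {set 'I_n}}) : {set {set 'I_n}} :=
  [set delta n @: B | B : {set 'I_n} in P].

Definition block_stab (n : nat) (P : {set {set 'I_n}}) : {set 'S_n} :=
  [set s : 'S_n | [forall B in P, s @: B == B]].

Definition is_interval (n : nat) (B : {set 'I_n}) : bool :=
  [exists a : 'I_n, exists b : 'I_n, B == [set x : 'I_n | a <= x <= b]].

Definition interval_partition (n : nat) (P : {set {set 'I_n}}) : bool :=
  partition P [set: 'I_n] && [forall B in P, is_interval B].

Definition trivial_block (n : nat) (B : {set 'I_n}) : bool := #|B| == 1.

Definition consecutive (n : nat) (B B' : {set 'I_n}) : bool :=
  [exists s in B, exists t in B', s.+1 == t].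

Definition no_consecutive_nontrivial (n : nat) (P : {set {set 'I_n}}) : Prop :=
  forall B B' : {set 'I_n}, B \in P -> B' \in P -> B != B' ->
    consecutive B B' -> trivial_block B \/ trivial_block B'.

Definition refines (T : finType) (Q P : {set {set T}}) : bool :=
  [forall B in Q, exists C in P, B \subset C].

(* The partition satisfying C that every partition satisfying C refines. It is
   unique if it exists, because refines is antisymmetric on partitions. *)
Definition coarsest (T : finType) (C : pred {set {set T}}) : {set {set T}} :=
  odflt set0
    [pick P : {set {set T}} | [&& partition P [set: T], C P &
       [forall Q : {set {set T}},
          partition Q [set: T] && C Q ==> refines Q P]]].

Definition hat (n : nat) (P : {set {set 'I_n}}) : {set {set 'I_n}} :=
  coarsest [pred Q | interval_partition Q && refines Q P].

(* lift ord0 : 'I_n.+1 -> 'I_n.+2 is i |-> i + 1, and lift ord_max is the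
   inclusion i |-> i; ord0 and ord_max are the least and greatest elements. *)

Definition add_first (n : nat) (P : {set {set 'I_n.+1}}) :
    {set {set 'I_n.+2}} :=
  (ord0 |: lift ord0 @: pblock P ord0)
    |: [set lift ord0 @: B | B : {set 'I_n.+1} in P & ord0 \notin B].

Definition add_last (n : nat) (P : {set {set 'I_n.+1}}) :
    {set {set 'I_n.+2}} :=
  (ord_max |: lift ord_max @: pblock P ord_max)
    |: [set lift ord_max @: B | B : {set 'I_n.+1} in P & ord_max \notin B].

Definition prime_part (n : nat) (P : {set {set 'I_n.+1}}) :
    {set {set 'I_n.+2}} :=
  coarsest [pred Q | refines Q (add_first (hat P)) &
                     refines Q (add_last (hat P))].

Definition involves (m n : nat) (s : 'S_m) (t : 'S_n) : bool :=
  [exists f : {ffun 'I_n -> 'I_m},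
     [forall j : 'I_n, forall k : 'I_n, (j < k) ==> (f j < f k)] &&
     [forall j : 'I_n, forall k : 'I_n, (s (f j) < s (f k)) == (t j < t k)]].

Definition Comp (n m : nat) (S : {set 'S_n}) : {set 'S_m} :=
  [set t : 'S_m | [forall s : 'S_n, involves t s ==> (s \in S)]].

(* Main.v *)
Require Import Defs.
From mathcomp Require Import all_boot all_fingroup.
From mathcomp Require Import zify.

(* An interval partition of [n] is the set L of its links, the z such that z
   and z + 1 share a block.  For Pi', z is a link iff z - 1 and z are links of
   the hat of Pi, where 0 and n count as links; so two consecutive nontrivial
   blocks of Pi' would be linked to each other.

   By symmetry the group is the union of S_Pi and delta S_Pi.  Unless Pi is the
   one-block partition, all n-patterns of t lie in the same one of these two
   sets: two patterns of t share the first and the last position that survive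
   both deletions, and these appear in increasing order in any element of S_Pi
   and in decreasing order in any element of delta S_Pi.  Replacing t by delta t,
   every n-pattern preserves the blocks of Pi; then x and t(x), pushed by one to
   either side through the choice of the deleted entry, are still linked, which
   says exactly that x and t(x) share a block of Pi'. *)

Set Implicit Arguments.
Unset Strict Implicit.
Unset Printing Implicit Defensive.

(** * Interval partitions given by their links *)

(** Stated on [nat], so that shifts by one need no bounds. The range is half-open: [z] stands for
    the bond between [z] and [z.+1]. *)
Definition linked (L : pred nat) (a b : nat) : bool :=
  all L (index_iota (minn a b) (maxn a b)).

Lemma linkedP (L : pred nat) a b :
  reflect (forall z, minn a b <= z < maxn a b -> L z) (linked L a b).
Proof.
by apply: (iffP allP) => h z hz; apply: h; rewrite mem_index_iota in hz *.
Qed.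

Lemma linkedxx L a : linked L a a.
Proof. by apply/linkedP => z; rewrite minnn maxnn; lia. Qed.

Lemma linkedC L a b : linked L a b = linked L b a.
Proof. by rewrite /linked minnC maxnC. Qed.

Lemma linked_trans L : transitive (linked L).
Proof.
move=> b a c /linkedP hab /linkedP hbc; apply/linkedP => z hz.
have [h|h] : minn a b <= z < maxn a b \/ minn b c <= z < maxn b c by lia.
- exact: hab.
- exact: hbc.
Qed.

Lemma linkedS L a : linked L a a.+1 = L a.
Proof.
apply/linkedP/idP => [h|h z hz]; first by apply: h; lia.
by have -> : z = a by lia.
Qed.

Lemma linked_sub L a b c d : minn a b <= c <= maxn a b ->
  minn a b <= d <= maxn a b -> linked L a b -> linked L c d.
Proof. by move=> hc hd /linkedP h; apply/linkedP => z hz; apply: h; lia. Qed.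

Lemma linked_equiv L m (D : {set 'I_m}) :
  {in D & &, equivalence_rel (fun x y : 'I_m => linked L x y)}.
Proof.
move=> x y z _ _ _; split; first exact: linkedxx.
move=> hxy; apply/idP/idP; last exact: linked_trans.
by apply: linked_trans; rewrite linkedC.
Qed.

Definition runs (L : pred nat) m : {set {set 'I_m}} :=
  equivalence_partition (fun x y : 'I_m => linked L x y) [set: 'I_m].

Lemma runs_partition L m : partition (runs L m) [set: 'I_m].
Proof. exact: equivalence_partitionP (@linked_equiv L m setT). Qed.

Lemma mem_pblock_runs L m (x y : 'I_m) :
  (y \in pblock (runs L m) x) = linked L x y.
Proof.
by rewrite (pblock_equivalence_partition (@linked_equiv L m setT)) ?inE.
Qed.

Lemma runsP L m (B : {set 'I_m}) :
  reflect (exists x : 'I_m, B = [set y : 'I_m | linked L x y]) (B \in runs L m).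
Proof.
apply: (iffP imsetP) => [[x _ ->]|[x ->]]; exists x; rewrite ?inE //;
  by apply/setP => y; rewrite !inE.
Qed.

(** * Refinement and coarsest partitions *)

Lemma partition_cover T (P : {set {set T}}) (x : T) :
  partition P [set: T] -> x \in cover P.
Proof. by move=> /cover_partition ->; rewrite inE. Qed.

Lemma pblockE (T : finType) (P : {set {set T}}) (B : {set T}) x :
  partition P [set: T] -> B \in P -> x \in B -> pblock P x = B.
Proof. by move=> /partition_trivIset tP; apply: def_pblock. Qed.

Lemma refinesP (T : finType) (Q P : {set {set T}}) :
  partition Q [set: T] -> partition P [set: T] ->
  reflect (forall x y, y \in pblock Q x -> y \in pblock P x) (refines Q P).
Proof.
move=> pQ pP; apply: (iffP forall_inP) => [h x y hy|h B hB].
  have xQ : x \in pblock Q x by rewrite mem_pblock partition_cover.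
  have bQ : pblock Q x \in Q by rewrite pblock_mem ?partition_cover.
  have /exists_inP[C hC sC] := h _ bQ.
  by rewrite (pblockE pP hC (subsetP sC _ xQ)) (subsetP sC).
have /set0Pn[x xB] := partition_neq0 pQ hB.
apply/exists_inP; exists (pblock P x); first by rewrite pblock_mem ?partition_cover.
by apply/subsetP => y yB; apply: h; rewrite (pblockE pQ hB xB).
Qed.

Lemma eq_partition (T : finType) (P Q : {set {set T}}) :
  partition P [set: T] -> partition Q [set: T] ->
  (forall x y, (y \in pblock P x) = (y \in pblock Q x)) -> P = Q.
Proof.
move=> pP pQ h; rewrite -(equivalence_partition_pblock pP).
rewrite -(equivalence_partition_pblock pQ).
by apply: eq_imset => x; apply/setP => y; rewrite !inE h.
Qed.

(** Two coarsest partitions satisfying [C] refine each other, hence coincide; the default [set0] is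
    never reached, since [P] is a candidate. *)
Lemma coarsestE (T : finType) (C : pred {set {set T}}) P :
  partition P [set: T] -> C P ->
  (forall Q, partition Q [set: T] -> C Q -> refines Q P) -> coarsest C = P.
Proof.
move=> pP CP max; rewrite /coarsest; case: pickP => [Q|/(_ P)] /=.
  case/and3P=> pQ CQ /forallP/(_ P); rewrite pP CP /= => rPQ.
  apply: eq_partition => // x y; apply/idP/idP.
    exact: (refinesP pQ pP (max _ pQ CQ)).
  exact: (refinesP pP pQ rPQ).
rewrite pP CP /= => /negP[]; apply/forallP => Q; apply/implyP => /andP[pQ CQ].
exact: max.
Qed.

(** * Interval partitions and the hat *)

Lemma runs_interval L m : interval_partition (runs L m).
Proof.
rewrite /interval_partition runs_partition /=; apply/forall_inP => B /runsP[x ->].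
(* The endpoints of the interval are the least and the greatest element of the run of [x]. *)
pose B0 := [pred y : 'I_m | linked L x y].
have B0x : B0 x by exact: linkedxx.
case: (arg_minnP (fun y : 'I_m => y : nat) B0x) => a /= ha mina.
case: (arg_maxnP (fun y : 'I_m => y : nat) B0x) => b /= hb maxb.
apply/existsP; exists a; apply/existsP; exists b; apply/eqP/setP => y.
rewrite !inE; apply/idP/idP => [h|h]; first by rewrite [a <= _]mina ?[_ <= b]maxb.
have hab : linked L a b by apply: linked_trans hb; rewrite linkedC.
by apply: linked_trans ha _; apply: linked_sub hab; lia.
Qed.

(** Both [z] and [z.+1] must be points of ['I_m], so no [z >= m.-1] is a link. *)
Definition adjacent m (P : {set {set 'I_m}}) : pred nat := fun z =>
  [exists x : 'I_m, exists y : 'I_m,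
    [&& x == z :> nat, y == z.+1 :> nat & y \in pblock P x]].

Lemma adjacentP m (P : {set {set 'I_m}}) z :
  reflect (exists x y : 'I_m, [/\ x = z :> nat, y = z.+1 :> nat & y \in pblock P x])
    (adjacent P z).
Proof.
apply: (iffP existsP) => -[x].
  by case/existsP=> y /and3P[/eqP ? /eqP ? ?]; exists x, y.
by case=> y [hx hy xy]; exists x; apply/existsP; exists y; rewrite hx hy xy !eqxx.
Qed.

Lemma interval_block_convex m (P : {set {set 'I_m}}) (x y u v : 'I_m) :
  interval_partition P -> y \in pblock P x ->
  minn x y <= u <= maxn x y -> minn x y <= v <= maxn x y -> v \in pblock P u.
Proof.
case/andP=> pP /forall_inP iP hy hu hv.
have hB : pblock P x \in P by rewrite pblock_mem ?partition_cover.
have hx : x \in pblock P x by rewrite mem_pblock partition_cover.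
have /existsP[a /existsP[b /eqP eB]] := iP _ hB.
have uB : u \in pblock P x by move: hx hy; rewrite eB !inE; lia.
by rewrite (pblockE pP hB uB); move: hx hy; rewrite eB !inE; lia.
Qed.

(** Along a run each point shares a block of [P] with its successor; induction on the distance
    carries the block of [x] to [y]. *)
Lemma linked_adjacent m (P : {set {set 'I_m}}) (x y : 'I_m) :
  partition P [set: 'I_m] -> linked (adjacent P) x y -> y \in pblock P x.
Proof.
move=> pP.
have tP := partition_trivIset pP.
have cP z : z \in cover P by exact: partition_cover.
wlog le_xy : x y / x <= y.
  move=> wl h; case/orP: (leq_total x y) => hxy; first exact: wl.
  rewrite -eq_pblock // eq_sym eq_pblock //; apply: wl => //.
  by rewrite linkedC.
move=> /linkedP h.
suff H k (z : 'I_m) : z = x + k :> nat -> z <= y -> z \in pblock P x.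
  by apply: (H (y - x)) => //; lia.
elim: k z => [|k IH] z hz hzy.
  by have -> : z = x by [apply: val_inj => /=; lia]; rewrite mem_pblock.
have /adjacentP[u [v [hu hv huv]]] : adjacent P (x + k) by apply: h; lia.
have -> : z = v by apply: val_inj => /=; lia.
have : u \in pblock P x by apply: IH; lia.
by rewrite -eq_pblock // => /eqP ->.
Qed.

(** Runs of links stay inside blocks of [P]. Conversely, neighbours in an interval that lies in a
    block of [P] are linked, so that interval lies in a run. *)
Lemma hatE m (P : {set {set 'I_m}}) :
  partition P [set: 'I_m] -> hat P = runs (adjacent P) m.
Proof.
move=> pP; apply: coarsestE; first exact: runs_partition.
  rewrite /= runs_interval; apply/(refinesP (runs_partition _ _) pP) => x y.
  by rewrite mem_pblock_runs; apply: linked_adjacent.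
move=> Q pQ /andP[iQ /(refinesP pQ pP) rQ].
apply/(refinesP pQ (runs_partition _ _)) => x y hxy; rewrite mem_pblock_runs.
apply/linkedP => z hz; have := ltn_ord x; have := ltn_ord y => ltx lty.
have z1 : z < m by lia.
have z2 : z.+1 < m by lia.
apply/adjacentP; exists (Ordinal z1), (Ordinal z2); split=> //.
by apply: rQ; apply: interval_block_convex hxy _ _ => //=; lia.
Qed.

Lemma interval_partitionE m (P : {set {set 'I_m}}) :
  interval_partition P -> P = runs (adjacent P) m.
Proof.
move=> iP; have pP := proj1 (andP iP); rewrite -hatE //.
apply/esym/coarsestE => //=; last by move=> Q _ /andP[].
by rewrite iP; apply/(refinesP pP pP).
Qed.

(** * The prime partition *)

(** Links after a point is added in front: old links shift by one, and 0 is the bond to the new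
    point. In [last_links] that bond is [n]. *)
Definition first_links (L : pred nat) : pred nat := fun z => (z == 0) || L z.-1.
Definition last_links (n : nat) (L : pred nat) : pred nat := fun z => (z == n) || L z.

Lemma linked_firstS L a b : linked (first_links L) a.+1 b.+1 = linked L a b.
Proof.
apply/linkedP/linkedP => h z hz.
  by have := h z.+1; rewrite /first_links /=; apply; lia.
by rewrite /first_links (h z.-1) ?orbT //; lia.
Qed.

Lemma linked_first0 L b : linked (first_links L) 0 b.+1 = linked L 0 b.
Proof.
rewrite -[RHS]linked_firstS; apply/idP/idP.
  by apply: (@linked_sub _ 0 b.+1); lia.
by apply: linked_trans; rewrite linkedS.
Qed.

Lemma linked_last n L a b : a <= n -> b <= n ->
  linked (last_links n L) a b = linked L a b.
Proof.
move=> ha hb; apply/linkedP/linkedP => h z hz.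
  by have /orP[/eqP|//] := h z hz; lia.
by rewrite /last_links h ?orbT.
Qed.

Lemma linked_lastS n L b : b <= n ->
  linked (last_links n L) n.+1 b = linked L n b.
Proof.
move=> hb; rewrite -[RHS](linked_last L (leqnn n) hb); apply/idP/idP.
  by apply: (@linked_sub _ n.+1 b); lia.
by apply: linked_trans; rewrite linkedC linkedS /last_links eqxx.
Qed.

Lemma linked_block L m (x y : 'I_m) : linked L x y ->
  [set z : 'I_m | linked L x z] = [set z : 'I_m | linked L y z].
Proof.
move=> h; apply/setP => z; rewrite !inE.
by have [_ ->] := @linked_equiv L m setT x y z (in_setT _) (in_setT _) (in_setT _).
Qed.

(* [add_first] and [add_last] are the instances e = 1, c = 1 and e = n + 1,
   c = n. *)
Lemma add_point_runs n (L M : pred nat) (e : 'I_n.+2) (c : 'I_n.+1) :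
  (forall x y : 'I_n.+1, linked M (lift e x) (lift e y) = linked L x y) ->
  (forall y : 'I_n.+1, linked M e (lift e y) = linked L c y) ->
  (e |: lift e @: pblock (runs L n.+1) c)
    |: [set lift e @: B | B : {set 'I_n.+1} in runs L n.+1 & c \notin B]
  = runs M n.+2.
Proof.
move=> hM he.
have blk_e : e |: lift e @: pblock (runs L n.+1) c = [set y : 'I_n.+2 | linked M e y].
  apply/setP => y; rewrite !inE; case: (unliftP e y) => [x ->|->].
    rewrite he eq_sym (negbTE (neq_lift _ _)) /= mem_imset ?mem_pblock_runs //.
    exact: lift_inj.
  by rewrite eqxx linkedxx.
have blk (x : 'I_n.+1) : ~~ linked L c x ->
    lift e @: [set y : 'I_n.+1 | linked L x y] = [set y : 'I_n.+2 | linked M (lift e x) y].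
  move=> hx; apply/setP => y; rewrite !inE; case: (unliftP e y) => [z ->|->].
    by rewrite hM mem_imset ?inE //; apply: lift_inj.
  rewrite [RHS]linkedC he (negbTE hx); apply/negP => /imsetP[z _] /eqP.
  by rewrite (negbTE (neq_lift _ _)).
apply/setP => B; rewrite blk_e in_setU1; apply/orP/runsP.
  case=> [/eqP ->|/imsetP[C]]; first by exists e.
  rewrite inE => /andP[/runsP[x ->]]; rewrite inE linkedC => hx ->.
  by exists (lift e x); apply: blk.
(* A run containing [e] is the enlarged block; any other run is the lift of an old block that avoids
   [c]. *)
case=> y ->; case hy: (linked M e y); first by left; rewrite (linked_block hy).
right; case: (unliftP e y) hy => [x ->|->]; last by rewrite linkedxx.
rewrite he => /negbT hx; rewrite -blk //; apply: imset_f.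
by rewrite !inE linkedC hx andbT; apply/runsP; exists x.
Qed.

Lemma add_first_runs n L :
  add_first (runs L n.+1) = runs (first_links L) n.+2.
Proof.
by apply: add_point_runs => [x y|y]; rewrite !lift0 ?linked_firstS ?linked_first0.
Qed.

Lemma add_last_runs n L :
  add_last (runs L n.+1) = runs (last_links n L) n.+2.
Proof.
apply: add_point_runs => [x y|y].
  by rewrite !lift_max linked_last ?leq_ord.
by rewrite lift_max linked_lastS ?leq_ord.
Qed.

Definition prime_links (n : nat) (L : pred nat) : pred nat :=
  predI (first_links L) (last_links n L).

Lemma linked_prime n L a b :
  linked (prime_links n L) a b =
    linked (first_links L) a b && linked (last_links n L) a b.
Proof. exact: all_predI. Qed.

(** Two points share a block of both enlarged partitions iff every bond between them is a link of
    both, so the coarsest common refinement keeps exactly the common links. *)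
Lemma prime_partE n (P : {set {set 'I_n.+1}}) :
  partition P [set: 'I_n.+1] ->
  prime_part P = runs (prime_links n (adjacent P)) n.+2.
Proof.
move=> pP; have pr := runs_partition.
rewrite /prime_part hatE // add_first_runs add_last_runs.
apply: coarsestE; first exact: pr.
  by apply/andP; split; apply/refinesP => // x y;
    rewrite !mem_pblock_runs linked_prime => /andP[].
move=> Q pQ /andP[/(refinesP pQ (pr _ _)) r1 /(refinesP pQ (pr _ _)) r2].
apply/(refinesP pQ (pr _ _)) => x y hxy; rewrite mem_pblock_runs linked_prime.
by rewrite -!mem_pblock_runs r1 ?r2.
Qed.

Lemma nontrivial_other m (B : {set 'I_m}) s :
  s \in B -> ~~ trivial_block B -> exists2 u, u \in B & u != s.
Proof.
move=> sB nB; have : 1 < #|B|.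
  by move: nB; rewrite /trivial_block (cardsD1 s) sB; lia.
rewrite (cardsD1 s) sB ltnS => /card_gt0P[u]; rewrite !inE => /andP[? ?].
by exists u.
Qed.

(** If neither block were trivial, [s.-1] and [t] would be prime links. The first gives [L s.-1],
    the second [L s], and together they make [s] a prime link, joining the two blocks. *)
Lemma prime_no_consecutive n L :
  no_consecutive_nontrivial (runs (prime_links n L) n.+2).
Proof.
move=> B B' /runsP[x ->] /runsP[y ->] neq /exists_inP[s hs /exists_inP[t ht /eqP st]].
have cut : ~~ prime_links n L s.
  apply: contraNN neq => h; apply/eqP; rewrite inE in hs; rewrite inE in ht.
  by rewrite (linked_block hs) (linked_block ht); apply: linked_block; rewrite -st linkedS.
case triv: (trivial_block _); first by left.
right; apply: contraNT cut => triv'.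
have [s' hs' ns] := nontrivial_other hs (negbT triv).
have [t' ht' nt] := nontrivial_other ht triv'.
rewrite !inE in hs hs' ht ht'.
have /linkedP lss : linked (prime_links n L) s s'.
  by apply: linked_trans hs'; rewrite linkedC.
have /linkedP ltt : linked (prime_links n L) t t'.
  by apply: linked_trans ht'; rewrite linkedC.
have {}ns : s' <> s :> nat by exact/eqP.
have {}nt : t' <> t :> nat by exact/eqP.
have lts' := ltn_ord s'; have lts := ltn_ord s; have lttm := ltn_ord t.
have lttm' := ltn_ord t'.
(* If [s' > s] or [t' < t], the missing bond [s] would lie inside a run; hence [s' < s] and
   [t < t']. *)
have [lt|le] := ltnP s s'; first by apply: lss; lia.
have [lt2|le2] := ltnP t' t; first by apply: ltt; lia.
have /andP[_ /orP[/eqP|h1]] : prime_links n L s.-1 by apply: lss; lia.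
  lia.
have /andP[/orP[/eqP t0|h2] _] : prime_links n L t by apply: ltt; lia.
  by move: t0; rewrite -st.
by rewrite -st /= in h2; rewrite /prime_links /= /first_links /last_links h1 h2 !orbT.
Qed.

(** * Reversal and block stabilisers *)

Lemma deltaE n (x : 'I_n) : delta n x = rev_ord x.
Proof. exact: permE. Qed.

Lemma delta_runs n L :
  (forall x y : 'I_n, linked L (rev_ord x) (rev_ord y) = linked L x y) ->
  delta_part (runs L n) = runs L n.
Proof.
move=> symL; have blk (x : 'I_n) : delta n @: [set y : 'I_n | linked L x y] =
    [set y : 'I_n | linked L (rev_ord x) y].
  apply/setP => y; rewrite -(rev_ordK y) -deltaE mem_imset; last exact: perm_inj.
  by rewrite !inE deltaE symL.
apply/setP => B; apply/imsetP/runsP => [[C /runsP[x ->] ->]|[x ->]].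
  by exists (rev_ord x); apply: blk.
exists [set y : 'I_n | linked L (rev_ord x) y]; last by rewrite blk rev_ordK.
by apply/runsP; exists (rev_ord x).
Qed.

Lemma linked_rev n (L : pred nat) :
  delta_part (runs L n) = runs L n ->
  forall x y : 'I_n, linked L (rev_ord x) (rev_ord y) = linked L x y.
Proof.
move=> eqP0.
have half (x y : 'I_n) : linked L x y -> linked L (rev_ord x) (rev_ord y).
  move=> xy; have pr := runs_partition L n.
  have cx : x \in cover (runs L n) by exact: partition_cover.
  have -> : linked L (rev_ord x) (rev_ord y) =
      (delta n y \in pblock (runs L n) (delta n x)).
    by rewrite mem_pblock_runs !deltaE.
  rewrite (pblockE (B := delta n @: pblock (runs L n) x) pr).
  - by rewrite imset_f // mem_pblock_runs.
  - by rewrite -{2}eqP0 imset_f // pblock_mem.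
  - by rewrite imset_f // mem_pblock.
move=> x y; apply/idP/idP; last exact: half.
by move/half; rewrite !rev_ordK.
Qed.

(** Reflection sends bond [z] to [n - z.+1] on [n.+1] points and to [n - z] on [n.+2] points, so it
    exchanges [first_links] and [last_links]. *)
Lemma prime_links_rev n L :
  (forall x y : 'I_n.+1, linked L (rev_ord x) (rev_ord y) = linked L x y) ->
  forall x y : 'I_n.+2,
    linked (prime_links n L) (rev_ord x) (rev_ord y) = linked (prime_links n L) x y.
Proof.
move=> symL.
have revL z : z < n -> L (n - z.+1) = L z.
  move=> hz; have h1 : z < n.+1 by lia.
  have h2 : z.+1 < n.+1 by lia.
  have := symL (Ordinal h2) (Ordinal h1); rewrite /= [RHS]linkedC linkedS => <-.
  by rewrite subSS subSn // linkedS.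
have revL' z : z <= n -> prime_links n L (n - z) = prime_links n L z.
  move=> hz; rewrite /prime_links /= /first_links /last_links andbC.
  congr (_ && _).
    case: z hz => [|z] hz; first by rewrite subn0 !eqxx.
    by rewrite revL // (_ : (_ == n) = false) //; lia.
  case: (ltnP z n) => hzn; last by have -> : z = n by [lia]; rewrite subnn !eqxx.
  by rewrite -(revL z) // -subnS (_ : (n - z == 0) = (z == n)) //; lia.
have half (x y : 'I_n.+2) : linked (prime_links n L) x y ->
    linked (prime_links n L) (rev_ord x) (rev_ord y).
  have ltx := ltn_ord x; have lty := ltn_ord y.
  move=> /linkedP h; apply/linkedP => z /= hz.
  by rewrite -revL'; [apply: h|]; lia.
move=> x y; apply/idP/idP; last exact: half.
by move/half; rewrite !rev_ordK.
Qed.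

(** By cardinality, a permutation mapping a block into itself maps it onto itself. *)
Lemma mem_block_stab n (P : {set {set 'I_n}}) (s : 'S_n) :
  partition P [set: 'I_n] ->
  reflect (forall x, s x \in pblock P x) (s \in block_stab P).
Proof.
move=> pP; rewrite inE; apply: (iffP forall_inP) => [h x|h B hB].
  have /h/eqP hx : pblock P x \in P by rewrite pblock_mem ?partition_cover.
  by rewrite -hx imset_f // mem_pblock partition_cover.
rewrite eqEcard card_imset ?leqnn ?andbT; last exact: perm_inj.
apply/subsetP => _ /imsetP[x xB ->].
by have := h x; rewrite (pblockE pP hB xB).
Qed.

Definition stab (L : pred nat) n (s : 'S_n) := [forall x : 'I_n, linked L x (s x)].

(** The coset of the stabiliser by the reversal, which is an involution. *)
Definition rev_stab (L : pred nat) n (s : 'S_n) := stab L (s * delta n)%g.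

Lemma stab_mul n L (s t : 'S_n) : stab L s -> stab L t -> stab L (s * t)%g.
Proof.
move=> /forallP hs /forallP ht; apply/forallP => x; rewrite permM.
exact: linked_trans (hs x) (ht _).
Qed.

Lemma stab_delta_conj n L (symL : forall x y : 'I_n,
    linked L (rev_ord x) (rev_ord y) = linked L x y) (s : 'S_n) : stab L s -> stab L (delta n * s * delta n)%g.
Proof.
move=> /forallP hs; apply/forallP => x.
by rewrite !permM !deltaE -symL rev_ordK.
Qed.

Lemma delta_mulK n (s : 'S_n) : (s * delta n * delta n = s)%g.
Proof. by apply/permP => x; rewrite !permM !deltaE rev_ordK. Qed.

(** The reversal normalises the stabiliser of a symmetric partition, so the stabiliser and this one
    coset already form a group. *)
Lemma mem_stab_delta n L (symL : forall x y : 'I_n,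
    linked L (rev_ord x) (rev_ord y) = linked L x y) (g : 'S_n) :
  (g \in <<block_stab (runs L n) :|: [set delta n]>>%g) = stab L g || rev_stab L g.
Proof.
have memS (s : 'S_n) : (s \in block_stab (runs L n)) = stab L s.
  apply/(mem_block_stab _ (runs_partition L n))/forallP => h x.
    by rewrite -mem_pblock_runs.
  by rewrite mem_pblock_runs.
apply/idP/idP.
  have gH : group_set [set s : 'S_n | stab L s || rev_stab L s].
    apply/group_setP; split=> [|s t]; rewrite !inE.
      by apply/orP; left; apply/forallP => x; rewrite perm1 linkedxx.
    rewrite /rev_stab => /orP[hs|hs] /orP[ht|ht]; apply/orP.
    - by left; apply: stab_mul.
    - by right; rewrite -mulgA; apply: stab_mul.
    - right; have -> : (s * t * delta n = s * delta n * (delta n * t * delta n))%g.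
        by rewrite !mulgA delta_mulK.
      by apply: stab_mul => //; apply: stab_delta_conj.
    - left; have -> : (s * t = s * delta n * (delta n * (t * delta n) * delta n))%g.
        by rewrite !mulgA !delta_mulK.
      by apply: stab_mul => //; apply: stab_delta_conj.
  have : (<<block_stab (runs L n) :|: [set delta n]>> \subset Group gH)%g.
    rewrite gen_subG; apply/subsetP => s; rewrite in_setU memS in_set1 /= inE.
    case/orP=> [->//|/eqP ->]; apply/orP; right; rewrite /rev_stab.
    by apply/forallP => x; rewrite permM !deltaE rev_ordK linkedxx.
  by move/subsetP=> h /h; rewrite inE.
case/orP=> h.
  by apply: mem_gen; rewrite in_setU memS h.
rewrite -[g]delta_mulK; apply: groupM; apply: mem_gen.
  by rewrite in_setU memS -/(rev_stab L g) h.
by rewrite !inE eqxx orbT.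
Qed.

(** * Patterns obtained by deleting one entry *)

(** An increasing map satisfies [x <= g x]; the same bound for its conjugate by reversal gives the
    opposite inequality. *)
Lemma increasing_ord_id m (g : 'I_m -> 'I_m) :
  (forall x y : 'I_m, x < y -> g x < g y) -> forall x, g x = x.
Proof.
have above (h : 'I_m -> 'I_m) : (forall x y : 'I_m, x < y -> h x < h y) ->
    forall x : 'I_m, x <= h x.
  move=> hh; suff H k (x : 'I_m) : x = k :> nat -> k <= h x by move=> x; apply: H.
  elim: k x => // k IH x hx; have lt := ltn_ord x.
  have lk : k < m by lia.
  have := IH (Ordinal lk) erefl; have := hh (Ordinal lk) x; rewrite /= hx; lia.
move=> hg x; apply: val_inj => /=.
have hx := above g hg x.
have := above (fun y => rev_ord (g (rev_ord y))) _ (rev_ord x).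
rewrite rev_ordK /=; have := ltn_ord (g x); have := ltn_ord x => l1 l2 h.
suff : m - x.+1 <= m - (g x).+1 by lia.
apply: h => y z yz; have := hg (rev_ord z) (rev_ord y).
have := ltn_ord (g (rev_ord z)); have := ltn_ord (g (rev_ord y)).
have := ltn_ord z; have := ltn_ord y; rewrite /=; lia.
Qed.

(** Position [i] and value [t i] are deleted; the two lifts undo the renumbering of the remaining
    positions and values. *)
Definition pattern_at n (t : 'S_n.+2) (i : 'I_n.+2) (s : 'S_n.+1) : Prop :=
  forall x, t (lift i x) = lift (t i) (s x).

Lemma lift_lt n (i : 'I_n.+2) (x y : 'I_n.+1) : (lift i x < lift i y) = (x < y).
Proof. by rewrite /= /bump; lia. Qed.

Lemma lift_factor n (f : 'I_n.+1 -> 'I_n.+2) (i : 'I_n.+2) :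
  (forall x, i != f x) -> exists g : 'I_n.+1 -> 'I_n.+1, forall x, f x = lift i (g x).
Proof.
(* The default [x] is never taken, because [f x] avoids [i]. *)
move=> hf; exists (fun x => odflt x (unlift i (f x))) => x.
by case: unliftP (hf x) => [y ->|->] //; rewrite eqxx.
Qed.

Lemma pattern_exists n (t : 'S_n.+2) (i : 'I_n.+2) : exists s, pattern_at t i s.
Proof.
have [x|g hg] := @lift_factor n (fun x => t (lift i x)) (t i).
  by rewrite (inj_eq perm_inj) neq_lift.
have ginj : injective g.
  move=> x y e; have := hg x; rewrite e -hg => /perm_inj; exact: lift_inj.
by exists (perm ginj) => x; rewrite permE hg.
Qed.

(** By counting, an embedding misses some point [i]; being increasing, it must be [lift i]. *)
Lemma involvesP n (t : 'S_n.+2) (s : 'S_n.+1) :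
  reflect (exists i, pattern_at t i s) (involves t s).
Proof.
apply: (iffP existsP) => [[f /andP[/forallP fup /forallP fs]]|[i hi]].
  have {}fup (x y : 'I_n.+1) : x < y -> f x < f y.
    by move=> xy; have /forallP/(_ y) := fup x; rewrite xy.
  have {}fs (x y : 'I_n.+1) : (t (f x) < t (f y)) = (s x < s y).
    by have /forallP/(_ y)/eqP := fs x.
  have [i hi] : exists i, forall x, i != f x.
    have /subsetPn[i _ hi] : ~~ ([set: 'I_n.+2] \subset codom f).
      apply/negP => /subset_leq_card; have := leq_image_card f predT.
      by rewrite cardsT !card_ord => h /leq_trans/(_ h); rewrite ltnn.
    by exists i => x; apply: contraNneq hi => ->; apply: codom_f.
  have [g hg] := lift_factor hi.
  have gid x : g x = x.
    by apply: increasing_ord_id => {}x y xy; rewrite -(lift_lt i) -!hg fup.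
  have [u hu] := pattern_exists t i.
  exists i => x; rewrite hu; congr lift.
  (* [s] and [u] record the relative order of the same entries of [t], so [s^-1 * u] is
     increasing. *)
  have us y : (s^-1 * u)%g y = y.
    apply: increasing_ord_id => {}y z yz; rewrite !permM -(lift_lt (t i)) -!hu.
    have fl v : lift i v = f v by rewrite hg gid.
    by rewrite !fl fs !permKV.
  by have := us (s x); rewrite permM permK.
exists [ffun x => lift i x]; apply/andP; split.
  apply/forallP => x; apply/forallP => y; apply/implyP => xy.
  by rewrite !ffunE lift_lt.
by apply/forallP => x; apply/forallP => y; rewrite !ffunE !hi !lift_lt.
Qed.

Lemma mem_Comp n (S : {set 'S_n.+1}) (t : 'S_n.+2) :
  reflect (forall i s, pattern_at t i s -> s \in S) (t \in Comp n.+2 S).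
Proof.
rewrite inE; apply: (iffP forallP) => h => [i s p|s].
  by apply: (implyP (h s)); apply/involvesP; exists i.
by apply/implyP => /involvesP[i]; apply: h.
Qed.

Lemma pattern_delta n (t : 'S_n.+2) i s :
  pattern_at t i s -> pattern_at (t * delta n.+2)%g i (s * delta n.+1)%g.
Proof.
move=> p x; rewrite !permM !deltaE p; apply: val_inj => /=.
have := ltn_ord (s x); have := ltn_ord (t i); rewrite /bump; lia.
Qed.

(** * Stabilisers of Pi and Pi' compared through patterns *)

(** A prime link [z] or [z.+1] yields [L z]. One of these lies between the bumped ends, unless the
    bumps merge neighbours [a] and [b]; then [i] and [j] lie on opposite sides of the bond. *)
Lemma linked_unbump n L a b i j :
  a <= n -> b <= n ->
  linked (prime_links n L) (bump i a) (bump j b) ->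
  linked (prime_links n L) i j -> linked L a b.
Proof.
move=> ha hb /linkedP hab /linkedP hij; apply/linkedP => z hz.
have link1 : prime_links n L z -> L z.
  by case/andP=> _ /orP[/eqP|//]; lia.
have link2 : prime_links n L z.+1 -> L z by case/andP.
have [h|[h|[h|h]]] :
  minn (bump i a) (bump j b) <= z < maxn (bump i a) (bump j b) \/
  minn (bump i a) (bump j b) <= z.+1 < maxn (bump i a) (bump j b) \/
  minn i j <= z < maxn i j \/ minn i j <= z.+1 < maxn i j by rewrite /bump; lia.
- exact/link1/hab.
- exact/link2/hab.
- exact/link1/hij.
- exact/link2/hij.
Qed.

Lemma stab_pattern n L (t : 'S_n.+2) i s :
  stab (prime_links n L) t -> pattern_at t i s -> stab L s.
Proof.
move=> /forallP ht p; apply/forallP => x.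
have := ht (lift i x); rewrite p => h.
by apply: linked_unbump h (ht i); apply: leq_ord.
Qed.

Lemma card_ord_lt m k : k <= m -> #|[set i : 'I_m | i < k]| = k.
Proof.
move=> hk; rewrite -sum1dep_card -(big_ord_widen m (fun=> 1) hk).
by rewrite sum1_card card_ord.
Qed.

(** Pigeonhole: more values lie below [t x] than positions lie below [x]. *)
Lemma exceedance_witness m (t : 'S_m) (x : 'I_m) :
  x < t x -> exists2 i : 'I_m, x < i & t i < t x.
Proof.
move=> xtx; suff /subsetPn[v] :
    ~~ ([set v : 'I_m | v < t x] \subset t @: [set i : 'I_m | i < x]).
  rewrite inE -(permKV t v) mem_imset ?inE -?leqNgt; last exact: perm_inj.
  move=> lt le; exists (t^-1 v)%g => //; rewrite ltn_neqAle le andbT.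
  by apply: contraTneq lt => /val_inj <-; rewrite ltnn.
apply/negP => /subset_leq_card; rewrite card_imset; last exact: perm_inj.
have card_lt (y : 'I_m) := card_ord_lt (ltnW (ltn_ord y)).
by rewrite !card_lt; lia.
Qed.

(* Deleting a position left or right of [x], with value below or above [t x],
   moves each end of the link [x] -- [t x] by at most one. *)
Lemma exceedance_linked n (L : pred nat) (t : 'S_n.+2) (x : 'I_n.+2) :
  (forall i : 'I_n.+2, i != x -> linked L (unbump i x) (unbump (t i) (t x))) ->
  x < t x -> linked (prime_links n L) x (t x).
Proof.
move=> link xtx; have ltt := ltn_ord (t x).
have tneq i : i != x -> t i <> t x :> nat.
  by move=> ne /val_inj/perm_inj/eqP; rewrite (negbTE ne).
(* Deleting the witness keeps [x] and lowers [t x] by one. *)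
have Lmid w : x <= w -> w.+1 < t x -> L w.
  have [i xi tix] := exceedance_witness xtx.
  have /link/linkedP h : i != x by apply: contraTneq xi => ->; rewrite ltnn.
  by move=> h1 h2; apply: h; rewrite /unbump; lia.
(* Deleting the first position lowers [x] by one, while the other end stays at or above [x]. *)
have Lleft : 0 < x -> L x.-1.
  move=> x0; have ne : ord0 != x by apply: contraTneq x0 => <-.
  have /linkedP h := link _ ne; have := tneq _ ne.
  by move=> neq; apply: h; rewrite /unbump /=; lia.
(* Deleting the largest value keeps [t x], while the other end is at most [x]. *)
have Lright : t x <= n -> L (t x).-1.
  move=> tn; pose i := (t^-1 ord_max)%g.
  have ti : t i = ord_max by rewrite permKV.
  have ne : i != x by apply: contraTneq tn => <-; rewrite ti /= ltnn.
  have /linkedP h := link _ ne; rewrite ti in h.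
  have nex : i <> x :> nat by apply/eqP.
  by apply: h; rewrite /unbump /=; lia.
apply/linkedP => z hz; apply/andP; split; rewrite /first_links /last_links /=.
  case: eqP => //= z0; have [zx|zx] := eqVneq z x.
    by rewrite zx; apply: Lleft; lia.
  by apply: Lmid; lia.
case: eqP => //= zn; have [ztx|ztx] := eqVneq z (t x).-1.
  by rewrite ztx; apply: Lright; lia.
by apply: Lmid; lia.
Qed.

(** A point with [t x < x] is treated as an exceedance of the inverse at [t x]: the condition [link]
    is symmetric in positions and values. *)
Lemma patterns_stab n L (t : 'S_n.+2) :
  (forall i s, pattern_at t i s -> stab L s) -> stab (prime_links n L) t.
Proof.
move=> h.
have link (i x : 'I_n.+2) : i != x -> linked L (unbump i x) (unbump (t i) (t x)).
  case: (unliftP i x) => [y ->|->]; last by rewrite eqxx.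
  move=> _; have [s p] := pattern_exists t i.
  by rewrite p !bumpK; apply/forallP/h: y.
apply/forallP => x; case: (ltngtP x (t x)) => [lt|gt|->]; last exact: linkedxx.
  by apply: exceedance_linked => // i; apply: link.
rewrite linkedC -{2}(permK t x); apply: exceedance_linked; rewrite ?permK //.
move=> i ne; rewrite linkedC -{2}(permKV t i).
by apply: link; apply: contraNneq ne => <-; rewrite permKV.
Qed.

(** * All patterns have the same type *)

(** If the order were reversed, the runs from [x] to [s x] and from [y] to [s y] would together
    cover everything between [x] and [y]. *)
Lemma stab_lt n L (s : 'S_n) (x y : 'I_n) :
  stab L s -> ~~ linked L x y -> x < y -> s x < s y.
Proof.
move=> /forallP hs nxy xy; rewrite ltnNge; apply: contraNN nxy => le.
have := hs x; have := hs y => hy hx.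
have [h|h] := leqP y (s x); first by apply: linked_sub hx; lia.
have [h'|h'] := leqP (s y) x; first by rewrite linkedC; apply: linked_sub hy; lia.
by apply: linked_trans hx _; apply: linked_sub hy; lia.
Qed.

(* The first and the last position that survive the deletion of both [i] and
   [j] would be in increasing order by [s] and in decreasing order by [s']. *)
Lemma patterns_same_type n L (t : 'S_n.+2) i j s s' :
  1 < n -> ~~ linked L 0 n.-1 -> ~~ linked L 1 n ->
  pattern_at t i s -> pattern_at t j s' -> stab L s -> ~~ rev_stab L s'.
Proof.
move=> n1 n0 nn ps ps' hs; apply/negP => hs'.
have li := ltn_ord i; have lj := ltn_ord j.
(* [p] is the first position other than [i] and [j]; [q] below is the last. *)
have [p [pi pj pS]] : exists p : nat, [/\ p <> i :> nat, p <> j :> nat &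
    p = 0 \/ p = 1 /\ (i = 0 :> nat \/ j = 0 :> nat) \/
    p = 2 /\ (i < 2 /\ j < 2)].
  have [h|h] : (0 <> i /\ 0 <> j) \/ (i = 0 :> nat \/ j = 0 :> nat) by lia.
    by exists 0; split; lia.
  have [h'|h'] : (1 <> i /\ 1 <> j) \/ (i = 1 :> nat \/ j = 1 :> nat) by lia.
    by exists 1; split; lia.
  by exists 2; split; lia.
have [q [qi qj qS]] : exists q : nat, [/\ q <> i :> nat, q <> j :> nat &
    q = n.+1 \/ q = n /\ (i = n.+1 :> nat \/ j = n.+1 :> nat) \/
    q = n.-1 /\ (n <= i /\ n <= j)].
  have [h|h] : (n.+1 <> i /\ n.+1 <> j) \/ (i = n.+1 :> nat \/ j = n.+1 :> nat)
    by lia.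
    by exists n.+1; split; lia.
  have [h'|h'] : (n <> i /\ n <> j) \/ (i = n :> nat \/ j = n :> nat) by lia.
    by exists n; split; lia.
  by exists n.-1; split; lia.
(* Only [i] and [j] can lie outside the range from [p] to [q], and one of them is deleted. So the
   ranks [x] and [y] miss the extremes 0 and [n] by at most one in total. *)
have far x y : x <= 1 -> n.-1 <= y <= n -> x + (n - y) <= 1 -> ~~ linked L x y.
  move=> hx hy hxy; have [x1|x1] := posnP x.
    by apply: contraNN n0 => h; rewrite x1 in h; apply: linked_sub h; lia.
  by apply: contraNN nn => h; apply: linked_sub h; lia.
have ranks (k : 'I_n.+2) : k = i \/ k = j -> exists x y : 'I_n.+1,
    [/\ lift k x = p :> nat, lift k y = q :> nat, x < y & ~~ linked L x y].
  move=> hk; have hx : unbump k p < n.+1 by case: hk => ->; rewrite /unbump; lia.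
  have hy : unbump k q < n.+1 by case: hk => ->; rewrite /unbump; lia.
  exists (Ordinal hx), (Ordinal hy).
  have kp : k != p :> nat by case: hk => ->; lia.
  have kq : k != q :> nat by case: hk => ->; lia.
  split; rewrite /= ?unbumpK ?inE ?[_ == nat_of_ord k]eq_sym //.
    by case: hk => ->; rewrite /unbump; lia.
  by apply: far; case: hk => ->; rewrite /unbump; lia.
have [x [y [xp yq xy nxy]]] := ranks i (or_introl erefl).
have [x' [y' [xp' yq' xy' nxy']]] := ranks j (or_intror erefl).
have := stab_lt hs nxy xy; rewrite -(lift_lt (t i)) -!ps.
have := stab_lt hs' nxy' xy'; rewrite -(lift_lt (rev_ord (t j))).
have := pattern_delta ps'; rewrite /pattern_at => pd.
have -> : rev_ord (t j) = (t * delta n.+2)%g j by rewrite permM deltaE.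
rewrite -!pd !permM !deltaE.
have -> : lift j x' = lift i x by apply: val_inj; rewrite /= in xp xp' *; rewrite xp xp'.
have -> : lift j y' = lift i y by apply: val_inj; rewrite /= in yq yq' *; rewrite yq yq'.
have := ltn_ord (t (lift i x)); have := ltn_ord (t (lift i y)); rewrite /=; lia.
Qed.

(** * The equality of groups and its exceptional case *)

Lemma trivial_runs2 (L : pred nat) (B : {set 'I_2}) :
  ~~ linked L 0 1 -> B \in runs L 2 -> trivial_block B.
Proof.
move=> n01 /runsP[x ->]; apply/cards1P; exists x; apply/setP => y.
rewrite !inE; apply/idP/eqP => [xy|->]; last exact: linkedxx.
have ltx := ltn_ord x; have lty := ltn_ord y.
apply/eqP; apply: contraNT n01 => ne; have {}ne : y <> x :> nat by exact/eqP.
by apply: linked_sub xy; lia.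
Qed.

(* The runs from 0 to n - 1 and from 1 to n are mirror images, and they overlap
   because [1 < n]. *)
Lemma linked_rev_full n (L : pred nat) : 1 < n ->
  (forall x y : 'I_n.+1, linked L (rev_ord x) (rev_ord y) = linked L x y) ->
  linked L 0 n.-1 || linked L 1 n -> linked L 0 n.
Proof.
move=> n1 symL; have eq_ends : linked L 1 n = linked L 0 n.-1.
  have := symL ord0 (inord n.-1); rewrite /= inordK; last by lia.
  by move=> <-; rewrite linkedC; congr linked; lia.
rewrite eq_ends orbb => h; have := h; rewrite -eq_ends; move: h.
by move=> h1 h2; apply: linked_trans h1 _; apply: linked_sub h2; lia.
Qed.

Lemma Comp_runs n L :
  (forall x y : 'I_n.+1, linked L (rev_ord x) (rev_ord y) = linked L x y) ->
  ~ (n = 1 /\ ~~ linked L 0 n) ->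
  Comp n.+2 <<block_stab (runs L n.+1) :|: [set delta n.+1]>>%g =
    <<block_stab (runs (prime_links n L) n.+2) :|: [set delta n.+2]>>%g.
Proof.
move=> symL small; have symL' := prime_links_rev symL.
apply/setP => t; rewrite mem_stab_delta //; apply/mem_Comp/idP; last first.
  move=> ht i s p; rewrite mem_stab_delta //; case/orP: ht => ht.
    by rewrite (stab_pattern ht p).
  by rewrite /rev_stab (stab_pattern ht (pattern_delta p)) orbT.
move=> h; have {}h i s : pattern_at t i s -> stab L s || rev_stab L s.
  by move/h; rewrite mem_stab_delta.
(* With a single block, every permutation is in the stabiliser. *)
have [full|nfull] := boolP (linked L 0 n).
  rewrite (@patterns_stab n L) // => i s _; apply/forallP => x.
  by have lx := leq_ord x; have ls := leq_ord (s x); apply: linked_sub full; lia.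
(* For [n = 0] there is one block, and [n = 1] without a link is excluded. *)
have n1 : 1 < n.
  case: n {symL' t h} L symL small nfull => [|[|n]] L symL small nfull //.
  by case: small.
have /norP[nl nr] := contra (linked_rev_full n1 symL) nfull.
(* The pattern at the first position decides the type of all the others. *)
have [s0 p0] := pattern_exists t ord0.
have [hs0|hr0] := orP (h _ _ p0).
  rewrite (@patterns_stab n L) // => i s p.
  by have := h _ _ p; rewrite (negbTE (patterns_same_type n1 nl nr p0 p hs0)) orbF.
(* In the reversed case the argument is applied to [t] followed by the reversal. *)
rewrite orbC [rev_stab _ _](@patterns_stab n L) // => i s p.
have p' := pattern_delta p; rewrite delta_mulK in p'.
have [hs|] := orP (h _ _ p'); last by rewrite /rev_stab delta_mulK.
by have := patterns_same_type n1 nl nr p' p0 hs; rewrite hr0.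
Qed.

Theorem theorem4p8 (n : nat) (Pi : {set {set 'I_n.+1}})
  (partPi : partition Pi [set: 'I_n.+1]) :
  (* (i) *)
  (interval_partition (prime_part Pi) /\
   no_consecutive_nontrivial (prime_part Pi))
  /\
  (* (ii) *)
  (interval_partition Pi ->
   no_consecutive_nontrivial Pi ->
   Pi = delta_part Pi ->
   (* the equality of groups fails for Pi = {{1}, {2}}, where the left-hand
      side is S_3 *)
   (~ (n.+1 = 2 /\ forall B : {set 'I_n.+1}, B \in Pi -> trivial_block B) ->
    Comp n.+2 <<block_stab Pi :|: [set delta n.+1]>>%g =
      <<block_stab (prime_part Pi) :|: [set delta n.+2]>>%g)
   /\ prime_part Pi = delta_part (prime_part Pi)).
Proof.
rewrite prime_partE //; split.
  by split; [apply: runs_interval | apply: prime_no_consecutive].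
set L := adjacent Pi => /interval_partitionE; rewrite -/L => eqPi _ symPi.
have symL : forall x y : 'I_n.+1, linked L (rev_ord x) (rev_ord y) = linked L x y.
  by apply: linked_rev; rewrite -eqPi -symPi.
split=> [small|]; last by rewrite delta_runs //; apply: prime_links_rev.
rewrite {1}eqPi; apply: Comp_runs => // -[n1 n01]; apply: small; split.
  by rewrite n1.
rewrite eqPi; clearbody L; clear -n1 n01; subst n => B; exact: trivial_runs2.
Qed.
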